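(* Let $\mathcal G$ be the planar Galilean conformal algebra with basis $\{L_n,H_n,I_n,J_n: n\in\mathbb Z\}$ and brackets $[L_n,L_m]=(m-n)L_{m+n}$, $[L_n,H_m]=mH_{m+n}$, $[L_n,I_m]=(m-n)I_{m+n}$, $[L_n,J_m]=(m-n)J_{m+n}$, $[H_n,I_m]=I_{m+n}$, $[H_n,J_m]=-J_{m+n}$, $[H_n,H_m]=[I_n,I_m]=[J_n,J_m]=[I_n,J_m]=0$. Let $\mathfrak p=\mathrm{Span}\{H_n,I_n,J_n: n\in\mathbb Z\}$, and let $\phi:\mathfrak p\to\mathbb C$ be a Lie algebra homomorphism such that $S^\phi=\{n\in\mathbb Z:\phi(H_n)\neq0\}$ is finite. Then $W(\phi)$ is irreducible if and only if $|S^\phi|\ge 2$.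
   Context: A Lie algebra homomorphism $\phi:\mathfrak p\to\mathbb C$ is a linear map vanishing on $[\mathfrak p,\mathfrak p]=\mathrm{Span}\{I_n,J_n\}$. $W(\phi)=\mathcal U(\mathcal G)\otimes_{\mathcal U(\mathfrak p)}\mathbb C w_\phi$, where $\mathbb C w_\phi$ is the one-dimensional $\mathfrak p$-module with $pw_\phi=\phi(p)w_\phi$. *)

(* Defs.v *)
From HB Require Import structures.
From mathcomp Require Import all_boot all_order all_algebra.
From Stdlib Require Import Rdefinitions.
From mathcomp Require Import reals Rstruct complex.
Set Implicit Arguments. Unset Strict Implicit. Unset Printing Implicit Defensive.
Import Order.TTheory GRing.Theory Num.Theory.
Local Open Scope ring_scope.

Definition C : numClosedFieldType := (Rdefinitions.R)[i]%C.

Record gca_module (M : lmodType C) := GcaModule {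
  actL : int -> {linear M -> M};
  actH : int -> {linear M -> M};
  actI : int -> {linear M -> M};
  actJ : int -> {linear M -> M};
  brLL : forall n m v, actL n (actL m v) - actL m (actL n v) = (m - n)%:~R *: actL (m + n) v;
  brLH : forall n m v, actL n (actH m v) - actH m (actL n v) = m%:~R *: actH (m + n) v;
  brLI : forall n m v, actL n (actI m v) - actI m (actL n v) = (m - n)%:~R *: actI (m + n) v;
  brLJ : forall n m v, actL n (actJ m v) - actJ m (actL n v) = (m - n)%:~R *: actJ (m + n) v;
  brHI : forall n m v, actH n (actI m v) - actI m (actH n v) = actI (m + n) v;
  brHJ : forall n m v, actH n (actJ m v) - actJ m (actH n v) = - actJ (m + n) v;
  brHH : forall n m v, actH n (actH m v) - actH m (actH n v) = 0;
  brII : forall n m v, actI n (actI m v) - actI m (actI n v) = 0;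
  brJJ : forall n m v, actJ n (actJ m v) - actJ m (actJ n v) = 0;
  brIJ : forall n m v, actI n (actJ m v) - actJ m (actI n v) = 0
}.

(* A linear functional phi on p = Span{H_n, I_n, J_n}, given by its values on
   the basis, is a Lie algebra homomorphism p -> C iff it kills all brackets
   of basis elements of p: [H_n,I_m] = I_{m+n}, [H_n,J_m] = -J_{m+n}, and all
   other brackets in p vanish. *)
Definition p_lie_hom (phiH phiI phiJ : int -> C) : Prop :=
  forall n m : int, phiI (m + n) = 0 /\ - phiJ (m + n) = 0.

Definition S_phi (phiH : int -> C) : int -> Prop := fun n => phiH n != 0.

Definition S_finite (phiH : int -> C) : Prop :=
  exists s : seq int, forall n, S_phi phiH n <-> n \in s.

Definition S_card_ge2 (phiH : int -> C) : Prop :=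
  exists n1 n2 : int, n1 != n2 /\ S_phi phiH n1 /\ S_phi phiH n2.

Definition phi_vector (N : lmodType C) (rN : gca_module N)
    (phiH phiI phiJ : int -> C) (v : N) : Prop :=
  forall n, actH rN n v = phiH n *: v /\ actI rN n v = phiI n *: v
            /\ actJ rN n v = phiJ n *: v.

Definition gca_hom (M N : lmodType C) (rM : gca_module M) (rN : gca_module N)
    (f : {linear M -> N}) : Prop :=
  forall n v, f (actL rM n v) = actL rN n (f v) /\ f (actH rM n v) = actH rN n (f v)
           /\ f (actI rM n v) = actI rN n (f v) /\ f (actJ rM n v) = actJ rN n (f v).

(* (M, w) is the induced module W(phi) = U(G) (x)_{U(p)} C w_phi, characterized
   (up to unique isomorphism) by the universal property of induction:
   w is a phi-vector, and for every G-module N and every phi-vector v in N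
   there is a unique G-module homomorphism M -> N sending w to v. *)
Definition is_induced_module (M : lmodType C) (rM : gca_module M) (w : M)
    (phiH phiI phiJ : int -> C) : Prop :=
  phi_vector rM phiH phiI phiJ w /\
  forall (N : lmodType C) (rN : gca_module N) (v : N),
    phi_vector rN phiH phiI phiJ v ->
    exists f : {linear M -> N}, gca_hom rM rN f /\ f w = v /\
      forall g : {linear M -> N}, gca_hom rM rN g -> g w = v -> forall x, g x = f x.

Definition gca_submodule (M : lmodType C) (rM : gca_module M) (P : M -> Prop) : Prop :=
  [/\ P 0, (forall x y, P x -> P y -> P (x + y)), (forall (a : C) x, P x -> P (a *: x))
    & forall n x, P x -> [/\ P (actL rM n x), P (actH rM n x), P (actI rM n x) & P (actJ rM n x)]].

Definition gca_irreducible (M : lmodType C) (rM : gca_module M) : Prop :=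
  (exists x : M, x != 0) /\
  forall P : M -> Prop, gca_submodule rM P ->
    (forall x, P x -> x = 0) \/ (forall x, P x).

(* Main.v *)
Require Import Defs.
From HB Require Import structures.
From mathcomp Require Import all_boot all_order all_algebra.
From Stdlib Require Import Rdefinitions.
From mathcomp Require Import reals Rstruct complex.
From mathcomp Require Import boolp functions.
From mathcomp Require Import ring zify.
Set Implicit Arguments. Unset Strict Implicit. Unset Printing Implicit Defensive.
Import Order.TTheory GRing.Theory Num.Theory.
Local Open Scope ring_scope.

(** Since phi kills [p,p], all I_n and J_n act by zero on W(phi), which is spanned by
    the monomials in the L_n applied to w.  On the graded space of the filtration by
    the number of L_n, the operator H_m - phi_m acts as the derivation
    L_n |-> - m phi_(m+n).  If |S| >= 2, a symbol killed by all of these derivations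
    has zero partial derivatives, because the product of a nonzero Laurent polynomial
    with one having at least two terms is never a monomial; so from any nonzero vector
    one descends to a multiple of w.  If S is contained in {k}, then L_k w is again a
    phi-vector.  An explicit module contains a nonzero phi-vector killed by L_k and
    another one not killed by it, so L_k w is a nonzero element of the kernel of a
    nonzero homomorphism from W(phi). *)

(** * Subspaces and submodules as modules of their own *)

Definition subspace (M : lmodType C) (P : M -> Prop) : Prop :=
  P 0 /\ forall (a : C) x y, P x -> P y -> P (a *: x + y).

(** The proof [hP] is an argument so that instance inference can read closure off the predicate. *)
Definition subspace_pred (M : lmodType C) (P : M -> Prop) (hP : subspace P) :
  {pred M} := fun x => `[< P x >].

Lemma subspace_predP (M : lmodType C) (P : M -> Prop) (hP : subspace P) x :
  x \in subspace_pred hP <-> P x.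
Proof. by split=> [/asboolP|/asboolP]. Qed.

Lemma subspace_pred_closed (M : lmodType C) (P : M -> Prop) (hP : subspace P) :
  submod_closed (subspace_pred hP).
Proof.
split; first by apply/subspace_predP; case: hP.
move=> a x y /subspace_predP px /subspace_predP py; apply/subspace_predP.
by case: hP => _; apply.
Qed.

HB.instance Definition _ (M : lmodType C) (P : M -> Prop) (hP : subspace P) :=
  GRing.isSubmodClosed.Build C M (subspace_pred hP)
    (GRing.submod_closed_semi (subspace_pred_closed hP)).

Record subspace_of (M : lmodType C) (P : M -> Prop) (hP : subspace P) :=
  SubspaceOf { sval_of :> M; _ : sval_of \in subspace_pred hP }.

HB.instance Definition _ M P hP := [isSub for @sval_of M P hP].
HB.instance Definition _ M P hP := [Choice of @subspace_of M P hP by <:].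
HB.instance Definition _ M P hP :=
  [SubChoice_isSubLmodule of @subspace_of M P hP by <:].

Lemma subspace_ofP (M : lmodType C) (P : M -> Prop) (hP : subspace P)
  (x : subspace_of hP) : P (val x).
Proof. exact/subspace_predP/(valP x). Qed.

Definition to_subspace (M : lmodType C) (P : M -> Prop) (hP : subspace P)
    (x : M) (px : P x) : subspace_of hP :=
  SubspaceOf (proj2 (subspace_predP hP x) px).

Definition restrict_fun (M : lmodType C) (P : M -> Prop) (hP : subspace P)
    (f : {linear M -> M}) (hf : forall x, P x -> P (f x))
    (x : subspace_of hP) : subspace_of hP :=
  to_subspace hP (hf _ (subspace_ofP x)).

Lemma restrict_fun_linear M P hP f hf : linear (@restrict_fun M P hP f hf).
Proof. by move=> a x y; apply: val_inj; rewrite /= linearP. Qed.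

HB.instance Definition _ M P hP f hf :=
  GRing.isLinear.Build C _ _ *:%R (@restrict_fun M P hP f hf)
    (@restrict_fun_linear M P hP f hf).

Definition restrict_linear M P hP f hf : {linear subspace_of hP -> subspace_of hP} :=
  @restrict_fun M P hP f hf.

(** The brackets are required on [P] alone, so operators satisfying them merely on a subspace, such
    as [wordH] on symmetric functions, still give a module. *)
Definition subspace_module (M : lmodType C) (P : M -> Prop) (hP : subspace P)
    (L H I J : int -> {linear M -> M})
    (PL : forall n x, P x -> P (L n x)) (PH : forall n x, P x -> P (H n x))
    (PI : forall n x, P x -> P (I n x)) (PJ : forall n x, P x -> P (J n x))
    (LL : forall n m v, P v -> L n (L m v) - L m (L n v) = (m - n)%:~R *: L (m + n) v)
    (LH : forall n m v, P v -> L n (H m v) - H m (L n v) = m%:~R *: H (m + n) v)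
    (LI : forall n m v, P v -> L n (I m v) - I m (L n v) = (m - n)%:~R *: I (m + n) v)
    (LJ : forall n m v, P v -> L n (J m v) - J m (L n v) = (m - n)%:~R *: J (m + n) v)
    (HI : forall n m v, P v -> H n (I m v) - I m (H n v) = I (m + n) v)
    (HJ : forall n m v, P v -> H n (J m v) - J m (H n v) = - J (m + n) v)
    (HH : forall n m v, P v -> H n (H m v) - H m (H n v) = 0)
    (II : forall n m v, P v -> I n (I m v) - I m (I n v) = 0)
    (JJ : forall n m v, P v -> J n (J m v) - J m (J n v) = 0)
    (IJ : forall n m v, P v -> I n (J m v) - J m (I n v) = 0) :
  gca_module (subspace_of hP).
Proof.
exists (fun n => restrict_linear hP (PL n)) (fun n => restrict_linear hP (PH n))
  (fun n => restrict_linear hP (PI n)) (fun n => restrict_linear hP (PJ n))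
  => n m v; have Pv := subspace_ofP v;
  apply: val_inj; rewrite ?linearB ?linearN ?linearZ /=.
- exact: LL.
- exact: LH.
- exact: LI.
- exact: LJ.
- exact: HI.
- exact: HJ.
- exact: HH.
- exact: II.
- exact: JJ.
- exact: IJ.
Defined.

Lemma submodule_subspace (M : lmodType C) (rM : gca_module M) P :
  gca_submodule rM P -> subspace P.
Proof. by case=> P0 PD PZ _; split=> // a x y px py; apply/PD/py/PZ. Qed.

Lemma submodule_actL (M : lmodType C) (rM : gca_module M) P :
  gca_submodule rM P -> forall n x, P x -> P (actL rM n x).
Proof. by case=> _ _ _ hs n x /(hs n) []. Qed.

Lemma submodule_actH (M : lmodType C) (rM : gca_module M) P :
  gca_submodule rM P -> forall n x, P x -> P (actH rM n x).
Proof. by case=> _ _ _ hs n x /(hs n) []. Qed.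

Lemma submodule_actI (M : lmodType C) (rM : gca_module M) P :
  gca_submodule rM P -> forall n x, P x -> P (actI rM n x).
Proof. by case=> _ _ _ hs n x /(hs n) []. Qed.

Lemma submodule_actJ (M : lmodType C) (rM : gca_module M) P :
  gca_submodule rM P -> forall n x, P x -> P (actJ rM n x).
Proof. by case=> _ _ _ hs n x /(hs n) []. Qed.

Definition submodule (M : lmodType C) (rM : gca_module M) P
    (hP : gca_submodule rM P) : gca_module (subspace_of (submodule_subspace hP)) :=
  subspace_module (submodule_subspace hP)
    (submodule_actL hP) (submodule_actH hP) (submodule_actI hP) (submodule_actJ hP)
    (fun n m v _ => brLL rM n m v) (fun n m v _ => brLH rM n m v)
    (fun n m v _ => brLI rM n m v) (fun n m v _ => brLJ rM n m v)
    (fun n m v _ => brHI rM n m v) (fun n m v _ => brHJ rM n m v)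
    (fun n m v _ => brHH rM n m v) (fun n m v _ => brII rM n m v)
    (fun n m v _ => brJJ rM n m v) (fun n m v _ => brIJ rM n m v).

(** The universal property maps M to the submodule; followed by the inclusion this map fixes w, so
    uniqueness makes it the identity. *)
Lemma induced_generated (M : lmodType C) (rM : gca_module M) (w : M)
    phiH phiI phiJ (P : M -> Prop) :
  is_induced_module rM w phiH phiI phiJ -> gca_submodule rM P -> P w ->
  forall x, P x.
Proof.
move=> [phiw univ] hP Pw x.
pose v := to_subspace (submodule_subspace hP) Pw.
have phiv : phi_vector (submodule hP) phiH phiI phiJ v.
  by move=> n; have [h1 [h2 h3]] := phiw n; split; [|split]; apply: val_inj;
    rewrite linearZ /=; [exact: h1|exact: h2|exact: h3].
have [f [hf [fw _]]] := univ _ _ _ phiv.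
have [f0 [_ [_ uniq0]]] := univ _ _ _ phiw.
have -> : x = val (f x).
  rewrite [LHS](uniq0 idfun) //.
  rewrite [RHS](uniq0 (val \o f)) //= ?fw // => n y /=.
  by have [-> [-> [-> ->]]] := hf n y.
exact: subspace_ofP.
Qed.

(** * The filtration by the number of operators L_n *)

(** Degrees are shifted by one: [filt d] is spanned by products of fewer than [d] operators L_n
    applied to w, so [filt 0] is zero. *)
Inductive filt (M : lmodType C) (rM : gca_module M) (w : M) : nat -> M -> Prop :=
| filt0 d : filt rM w d 0
| filtD d x y : filt rM w d x -> filt rM w d y -> filt rM w d (x + y)
| filtZ d a x : filt rM w d x -> filt rM w d (a *: x)
| filt_gen d : filt rM w d.+1 w
| filtL d n x : filt rM w d x -> filt rM w d.+1 (actL rM n x).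

Lemma filtN (M : lmodType C) (rM : gca_module M) (w : M) d x :
  filt rM w d x -> filt rM w d (- x).
Proof. by rewrite -scaleN1r; apply: filtZ. Qed.

Lemma filtB (M : lmodType C) (rM : gca_module M) (w : M) d x y :
  filt rM w d x -> filt rM w d y -> filt rM w d (x - y).
Proof. by move=> ? /filtN; apply: filtD. Qed.

Lemma filt_sum (M : lmodType C) (rM : gca_module M) (w : M) d
    (I : eqType) (r : seq I) (F : I -> M) :
  (forall i, i \in r -> filt rM w d (F i)) ->
  filt rM w d (\sum_(i <- r) F i).
Proof.
by move=> h; rewrite big_seq; apply: big_ind => //; [apply: filt0|apply: filtD].
Qed.

Lemma filtS (M : lmodType C) (rM : gca_module M) (w : M) d x :
  filt rM w d x -> filt rM w d.+1 x.
Proof.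
elim=> {d x} [d|d x y _ ? _ ?|d a x _ ?|d|d n x _ ?].
- exact: filt0.
- exact: filtD.
- exact: filtZ.
- exact: filt_gen.
- exact: filtL.
Qed.

Lemma filt0_eq0 (M : lmodType C) (rM : gca_module M) (w : M) x :
  filt rM w 0 x -> x = 0.
Proof.
suff h d : filt rM w d x -> d = 0%N -> x = 0 by move/h; apply.
elim=> {d x} [d|d x y _ hx _ hy|d a x _ hx|d|d n x _ _] // E.
  by rewrite hx ?hy ?addr0.
by rewrite hx ?scaler0.
Qed.

Lemma filt1_gen (M : lmodType C) (rM : gca_module M) (w : M) x :
  filt rM w 1 x -> exists a, x = a *: w.
Proof.
suff h d : filt rM w d x -> d = 1%N -> exists a, x = a *: w by move/h; apply.
elim=> {d x} [d|d x y _ hx _ hy|d a x _ hx|d|d n x hx _] E.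
- by exists 0; rewrite scale0r.
- by have [a ->] := hx E; have [b ->] := hy E; exists (a + b); rewrite scalerDl.
- by have [b ->] := hx E; exists (a * b); rewrite scalerA.
- by exists 1; rewrite scale1r.
by exists 0; case: E hx => -> /filt0_eq0 ->; rewrite linear0 scale0r.
Qed.

Lemma filtL_pred (M : lmodType C) (rM : gca_module M) (w : M) d n x :
  filt rM w d.-1 x -> filt rM w d (actL rM n x).
Proof.
case: d => [/filt0_eq0 ->|d /=]; first by rewrite linear0; apply: filt0.
exact: filtL.
Qed.

Lemma filt_pred (M : lmodType C) (rM : gca_module M) (w : M) d x :
  filt rM w d.-1 x -> filt rM w d x.
Proof. by case: d => // d; apply: filtS. Qed.

(* In the associated graded space, generated by commuting L_n, the pairs (n, y)
   list the partial derivatives y = dx/dL_n: the second clause says that H_m - phi_m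
   acts as the derivation with L_n |-> - m phi_(m+n), the third is Euler's identity. *)
Definition derivatives (M : lmodType C) (rM : gca_module M) (w : M)
    (phiH : int -> C) (d : nat) (x : M) (r : seq (int * M)) : Prop :=
  [/\ forall p, p \in r -> filt rM w d.-1 p.2,
      forall m : int, filt rM w d.-2
        (actH rM m x - phiH m *: x
         + m%:~R *: \sum_(p <- r) phiH (m + p.1) *: p.2)
    & filt rM w d.-1 (d.-1%:R *: x - \sum_(p <- r) actL rM p.1 p.2)].

Lemma derivatives_actH (M : lmodType C) (rM : gca_module M) (w : M) phiH d x r m :
  derivatives rM w phiH d.+1 x r -> filt rM w d (actH rM m x - phiH m *: x).
Proof.
move=> [r1 r2 _].
rewrite -[X in filt _ _ _ X](addrK
  (m%:~R *: \sum_(p <- r) phiH (m + p.1) *: p.2)).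
apply: filtB; first exact/filt_pred/r2.
by apply/filtZ/filt_sum => p /r1 ?; apply: filtZ.
Qed.

Lemma filt_derivatives (M : lmodType C) (rM : gca_module M) (w : M)
    phiH phiI phiJ d x :
  phi_vector rM phiH phiI phiJ w -> filt rM w d x ->
  exists r, derivatives rM w phiH d x r.
Proof.
move=> phiw; elim=> {d x}
  [d|d x y _ [r [r1 r2 r3]] _ [s [s1 s2 s3]]|d a x _ [r [r1 r2 r3]]|d
  |d k x hx [r [r1 r2 r3]]].
- exists [::]; split=> // [m|]; rewrite big_nil !(linear0, scaler0, subr0, addr0);
    exact: filt0.
- exists (r ++ s); split=> [p|m|].
  + by rewrite mem_cat => /orP[/r1|/s1].
  + have := filtD (r2 m) (s2 m); congr filt.
    rewrite addrACA [X in X + _ = _]addrACA -opprD -!scalerDr -linearD.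
    by rewrite big_cat.
  + have := filtD r3 s3; congr filt.
    by rewrite big_cat /= scalerDr opprD addrACA.
- exists [seq (p.1, a *: p.2) | p <- r]; split=> [p|m|].
  + by case/mapP=> q /r1 hq ->; apply: filtZ.
  + have := filtZ a (r2 m); congr filt.
    have -> : \sum_(p <- [seq (p.1, a *: p.2) | p <- r]) phiH (m + p.1) *: p.2
        = a *: \sum_(p <- r) phiH (m + p.1) *: p.2.
      rewrite big_map scaler_sumr; apply: eq_bigr => p _.
      by rewrite !scalerA mulrC.
    rewrite [actH rM m (a *: x)]linearZ /= !scalerDr scalerN !scalerA.
    by rewrite [phiH m * a]mulrC [m%:~R * a]mulrC.
  + have := filtZ a r3; congr filt.
    rewrite big_map /= scalerDr scalerN scaler_sumr !scalerA mulrC; congr (_ - _).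
    by apply: eq_bigr => p _; rewrite linearZ.
- exists [::]; split=> // [m|]; rewrite big_nil.
    by have [-> _] := phiw m; rewrite subrr scaler0 addr0; apply: filt0.
  by rewrite subr0; case: d => [|d]; [rewrite scale0r; apply: filt0
    |apply/filtZ/filt_gen].
case: d hx r1 r2 r3 => [/filt0_eq0 -> _ _ _|d hx r1 r2 r3].
  exists [::]; split=> // [m|]; rewrite big_nil !(linear0, scaler0, subr0, addr0);
    exact: filt0.
(* Leibniz rule: the factor L_k contributes x at index k, and L_k multiplies the derivatives of
   x. *)
exists ((k, x) :: [seq (p.1, actL rM k p.2) | p <- r]); split=> [p|m|] /=.
- rewrite inE => /orP[/eqP -> //|/mapP[q /r1 hq ->]]; exact: filtL.
- rewrite big_cons big_map /=.
  have hHx m' := derivatives_actH m' (And3 r1 r2 r3 : derivatives rM w phiH d.+1 x r).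
  (* The commutator of H_m and L_k is - m H_(m+k), and H_(m+k) acts on x as phi_(m+k) modulo lower
     degree; this is the term of index k. *)
  have := filtB (filtL_pred k (r2 m)) (filtZ m%:~R (hHx (m + k))); congr filt.
  have -> : actH rM m (actL rM k x)
      = actL rM k (actH rM m x) - m%:~R *: actH rM (m + k) x.
    by rewrite -brLH subKr.
  have -> : actL rM k (actH rM m x - phiH m *: x
        + m%:~R *: \sum_(p <- r) phiH (m + p.1) *: p.2)
      = actL rM k (actH rM m x) - phiH m *: actL rM k x
        + m%:~R *: \sum_(p <- r) phiH (m + p.1) *: actL rM k p.2.
    rewrite linearD linearB !linearZ /= linear_sum /=.
    by congr (_ + _ *: _); apply: eq_bigr => p _; rewrite linearZ.
  rewrite scalerBr scalerDr opprB [X in _ = X + _]addrAC -!addrA.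
  by congr (_ + (_ + _)); rewrite addrA addrC [X in - _ + X]addrC.
rewrite big_cons big_map /=.
(* Exchanging L_k with the L of index [p.1] costs a multiple of a single L, hence drops one
   degree. *)
have hbr : filt rM w d.+1
    (\sum_(p <- r) (k - p.1)%:~R *: actL rM (k + p.1) p.2).
  by apply: filt_sum => p /r1 hp; apply/filtZ/filtL.
have := filtB (filtL k r3) hbr; congr filt.
rewrite linearB linearZ /= linear_sum -addn1 natrD scalerDl scale1r opprD /=.
rewrite [RHS]addrA addrK -addrA; congr (_ + _).
rewrite -opprD -big_split; congr (- _); apply: eq_bigr => p _ /=.
by rewrite -brLL addrCA subrr addr0.
Qed.

Lemma filt_actH_sub (M : lmodType C) (rM : gca_module M) (w : M)
    phiH phiI phiJ d x m :
  phi_vector rM phiH phiI phiJ w -> filt rM w d.+1 x ->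
  filt rM w d (actH rM m x - phiH m *: x).
Proof. by move=> phiw /(filt_derivatives phiw) [r /derivatives_actH]. Qed.

(** * Convolution by a finitely supported sequence *)

Lemma seq_int_max (P : int -> Prop) (s : seq int) n0 :
  n0 \in s -> P n0 -> exists n, P n /\ forall m, m \in s -> P m -> m <= n.
Proof.
move=> n0s Pn0; elim: s n0 n0s Pn0 => // a s IH n0 n0s Pn0.
have [[n ns Pn]|no] := pselect (exists2 n, n \in s & P n); last first.
  exists n0; split=> // m ms Pm.
  have sub k : k \in a :: s -> P k -> k = a.
    by rewrite inE => /orP[/eqP //|ks Pk]; case: no; exists k.
  by rewrite (sub m) // (sub n0).
have [k [Pk kmax]] := IH _ ns Pn.
have [[Pa ak]|na] := pselect (P a /\ k < a).
  exists a; split=> // m; rewrite inE => /orP[/eqP -> //|ms Pm].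
  exact: le_trans (kmax m ms Pm) (ltW ak).
exists k; split=> // m; rewrite inE => /orP[/eqP -> Pa|]; last exact: kmax.
by rewrite leNgt; apply/negP => ak; apply: na.
Qed.

Lemma seq_int_min (P : int -> Prop) (s : seq int) n0 :
  n0 \in s -> P n0 -> exists n, P n /\ forall m, m \in s -> P m -> n <= m.
Proof.
move=> n0s Pn0.
have [||n [Pn nmax]] := @seq_int_max (fun n => P (- n)) (map -%R s) (- n0).
- exact: map_f.
- by rewrite opprK.
exists (- n); split=> // m ms Pm; rewrite lerNl; apply: nmax; last by rewrite opprK.
exact: map_f.
Qed.

(** A list of derivatives may repeat an index; this collects the entries into one derivative per
    index. *)
Lemma sum_by_index (M : lmodType C) (r : seq (int * M)) (F : int -> {linear M -> M}) :
  \sum_(p <- r) F p.1 p.2 =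
  \sum_(n <- undup (map fst r)) F n (\sum_(p <- r | p.1 == n) p.2).
Proof.
under [RHS]eq_bigr => n _ do rewrite linear_sum.
rewrite [RHS](exchange_big_dep predT) //=.
rewrite big_seq [RHS]big_seq; apply: eq_bigr => p pr.
rewrite (eq_bigl (pred1 p.1)) => [|n]; last by rewrite eq_sym.
rewrite -big_filter filter_pred1_uniq ?undup_uniq ?mem_undup ?map_f //.
by rewrite big_seq1.
Qed.

(* As Laurent polynomials, the product of [c] with a nonzero [y] has distinct
   lowest and highest terms, so it cannot be concentrated in one degree. *)
Lemma convolution_eq0 (M : lmodType C) (Q : M -> Prop) (c : int -> C)
    (r : seq (int * M)) :
  subspace Q -> S_finite c -> S_card_ge2 c ->
  (forall m, m != 0 -> Q (\sum_(p <- r) c (m + p.1) *: p.2)) ->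
  forall n, Q (\sum_(p <- r | p.1 == n) p.2).
Proof.
move=> hQ [t ct] [k1 [k2 [k12 [ck1 ck2]]]] hr n0.
set y := fun n => \sum_(p <- r | p.1 == n) p.2.
pose s := undup (map fst r).
have QZ a x : Q x -> Q (a *: x).
  by case: hQ => Q0 QL Qx; rewrite -[_ *: _]addr0; apply: QL.
have Q_sum (F : int -> M) (l : seq int) : (forall n, n \in l -> Q (F n)) ->
    Q (\sum_(n <- l | n \in l) F n).
  move=> h; apply: big_ind => //; first by case: hQ.
  by move=> u v Qu Qv; case: hQ => _ /(_ 1 u v Qu Qv); rewrite scale1r.
have conv m : \sum_(p <- r) c (m + p.1) *: p.2 = \sum_(n <- s) c (m + n) *: y n.
  exact: (sum_by_index r (fun n => c (m + n) \*: (idfun : {linear M -> M}))).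
have in_s n : ~ Q (y n) -> n \in s.
  move=> NQ; apply: contrapT => ns; apply: NQ.
  rewrite /y big_seq_cond big1 => [|p]; first by case: hQ.
  by case/andP=> pr /eqP pN; case: ns; rewrite mem_undup -pN map_f.
(* If [y N] is the only term outside [Q] with nonzero coefficient, it can be isolated and divided by
   [c (m + N)]. *)
have edge N m : ~ Q (y N) -> m != 0 -> c (m + N) != 0 ->
    ~ (forall n, n \in s -> n != N -> Q (y n) \/ c (m + n) = 0).
  move=> NQ m0 cN h.
  have Ns := in_s N NQ.
  have := hr m m0; rewrite conv (bigD1_seq N) ?undup_uniq //= => hQN.
  have Qrest : Q (\sum_(n <- s | n != N) c (m + n) *: y n).
    rewrite -big_filter big_seq; apply: Q_sum => n.
    rewrite mem_filter => /andP[nN /h/(_ nN)[|->]]; first exact: QZ.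
    by rewrite scale0r; case: hQ.
  apply: NQ; rewrite -[y N]scale1r -(mulVf cN) -scalerA; apply: QZ.
  by case: hQ => _ /(_ (-1) _ _ Qrest hQN); rewrite scaleN1r addrCA addNr addr0.
apply: contrapT => bad0.
have [N [badN maxN]] := seq_int_max (P := fun n => ~ Q (y n)) (in_s n0 bad0) bad0.
have [N' [badN' minN']] := seq_int_min (P := fun n => ~ Q (y n)) (in_s n0 bad0) bad0.
have [a [ca maxa]] := seq_int_max (P := S_phi c) (proj1 (ct k1) ck1) ck1.
have [b [cb minb]] := seq_int_min (P := S_phi c) (proj1 (ct k1) ck1) ck1.
have c0l n : n < b -> c n = 0.
  move=> nb; apply: contrapT => /eqP cn.
  by have := minb n (proj1 (ct n) cn) cn; rewrite leNgt nb.
have c0r n : a < n -> c n = 0.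
  move=> nb; apply: contrapT => /eqP cn.
  by have := maxa n (proj1 (ct n) cn) cn; rewrite leNgt nb.
(* At m = b - N, indices below N meet zeros of [c] and those above N lie in [Q], so [edge] applies
   unless m = 0. *)
have eqb : b - N = 0.
  apply: contrapT => /eqP m0; apply: (edge N (b - N) badN m0); first by rewrite subrK.
  move=> n ns nN; have [lt_nN|le_Nn] := ltP n N; first by right; apply: c0l; lia.
  by left; apply: contrapT => badn; have := maxN n ns badn; lia.
have eqa : a - N' = 0.
  apply: contrapT => /eqP m0; apply: (edge N' (a - N') badN' m0);
    first by rewrite subrK.
  move=> n ns nN; have [lt_nN|le_Nn] := ltP N' n; first by right; apply: c0r; lia.
  by left; apply: contrapT => badn; have := minN' n ns badn; lia.
(* Now a = N' <= N = b, so the support of [c] lies in a single point, against [k1 != k2]. *)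
have := minN' N (in_s N badN) badN.
have := maxa k1 (proj1 (ct k1) ck1) ck1; have := minb k1 (proj1 (ct k1) ck1) ck1.
have := maxa k2 (proj1 (ct k2) ck2) ck2; have := minb k2 (proj1 (ct k2) ck2) ck2.
by lia.
Qed.

(** * Descent to the generator *)

(** The bracket of L_k with I_n is a multiple of some I, so being killed by all I passes from x to
    L_k x. *)
Lemma actI_eq0 (M : lmodType C) (rM : gca_module M) (w : M) d x :
  (forall n, actI rM n w = 0) -> filt rM w d x -> forall n, actI rM n x = 0.
Proof.
move=> Iw; elim=> {d x} [d|d x y _ hx _ hy|d a x _ hx|d|d k x _ hx] n.
- by rewrite linear0.
- by rewrite linearD /= hx hy addr0.
- by rewrite linearZ /= hx scaler0.
- exact: Iw.
have := brLI rM k n x; rewrite !hx linear0 scaler0 sub0r => /eqP.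
by rewrite oppr_eq0 => /eqP.
Qed.

Lemma actJ_eq0 (M : lmodType C) (rM : gca_module M) (w : M) d x :
  (forall n, actJ rM n w = 0) -> filt rM w d x -> forall n, actJ rM n x = 0.
Proof.
move=> Jw; elim=> {d x} [d|d x y _ hx _ hy|d a x _ hx|d|d k x _ hx] n.
- by rewrite linear0.
- by rewrite linearD /= hx hy addr0.
- by rewrite linearZ /= hx scaler0.
- exact: Jw.
have := brLJ rM k n x; rewrite !hx linear0 scaler0 sub0r => /eqP.
by rewrite oppr_eq0 => /eqP.
Qed.

Lemma filt_subspace (M : lmodType C) (rM : gca_module M) (w : M) d :
  subspace (filt rM w d).
Proof. by split=> [|a x y hx hy]; [apply: filt0|apply/filtD/hy/filtZ]. Qed.

Lemma filt_mono (M : lmodType C) (rM : gca_module M) (w : M) d e x :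
  filt rM w d x -> filt rM w (d + e) x.
Proof. by move=> h; elim: e => [|e]; rewrite ?addn0 // addnS; apply: filtS. Qed.

(** The union of the filtration is a submodule containing w; it is stable under H_n because H_n -
    phi_n lowers degree. *)
Lemma filt_exhaustive (M : lmodType C) (rM : gca_module M) (w : M)
    phiH phiI phiJ :
  (forall n, phiI n = 0) -> (forall n, phiJ n = 0) ->
  is_induced_module rM w phiH phiI phiJ -> forall x, exists d, filt rM w d x.
Proof.
move=> I0 J0 hW; have phiw := proj1 hW.
apply: (induced_generated hW); last by exists 1%N; apply: filt_gen.
split=> [|x y [d hx] [e hy]|a x [d hx]|n x [d hx]].
- by exists 0%N; apply: filt0.
- exists (d + e)%N; apply: filtD; first exact: filt_mono.
  by rewrite [X in filt _ _ X _]addnC; apply: filt_mono.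
- by exists d; apply: filtZ.
have Iw k : actI rM k w = 0 by have [_ [-> _]] := phiw k; rewrite I0 scale0r.
have Jw k : actJ rM k w = 0 by have [_ [_ ->]] := phiw k; rewrite J0 scale0r.
split.
- by exists d.+1; apply: filtL.
- exists d; rewrite -(subrK (phiH n *: x) (actH rM n x)).
  by apply/filtD/filtZ/hx/(filt_actH_sub n phiw)/filtS.
- by exists 0%N; rewrite (actI_eq0 Iw hx); apply: filt0.
- by exists 0%N; rewrite (actJ_eq0 Jw hx); apply: filt0.
Qed.

(* If every H_m - phi_m kills [x], the derivatives of its symbol vanish and Euler's
   identity lowers its degree; otherwise some H_m - phi_m does. *)
Lemma submodule_gen (M : lmodType C) (rM : gca_module M) (w : M)
    phiH phiI phiJ (P : M -> Prop) d x :
  phi_vector rM phiH phiI phiJ w -> S_finite phiH -> S_card_ge2 phiH ->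
  gca_submodule rM P -> P x -> x != 0 -> filt rM w d x -> P w.
Proof.
move=> phiw fin card hP; elim: d x => [|d IH] x Px x0 hx.
  by move: x0; rewrite (filt0_eq0 hx) eqxx.
have [_ PD PZ _] := hP.
have [[m mx]|singular] := pselect (exists m, actH rM m x - phiH m *: x != 0).
  apply: IH mx _; last exact: filt_actH_sub phiw hx.
  by rewrite -scaleNr; apply: PD; [apply: submodule_actH hP _ _ Px|apply: PZ].
have Hx m : actH rM m x - phiH m *: x = 0.
  by apply: contrapT => /eqP h; apply: singular; exists m.
case: d IH hx => [_ /filt1_gen [a xa]|d IH hx].
  have a0 : a != 0 by apply: contra_neq x0 => a0; rewrite xa a0 scale0r.
  by rewrite -[w]scale1r -(mulVf a0) -scalerA -xa; apply: PZ.
apply: (IH x) => //.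
have [r [r1 r2 r3]] := filt_derivatives phiw hx.
have yQ : forall n, filt rM w d (\sum_(p <- r | p.1 == n) p.2).
  apply: (convolution_eq0 (filt_subspace rM w d) fin card) => m m0.
  (* The factor m must be divided out, whence the restriction to nonzero m in [convolution_eq0]. *)
  have := r2 m; rewrite Hx add0r => /(filtZ m%:~R^-1).
  by rewrite scalerA mulVf ?scale1r // intr_eq0.
(* Euler's identity recovers x from its derivatives. Only after grouping by index do these lie in
   [filt d], which puts x in [filt d.+1]. *)
rewrite -[x]scale1r -(@mulVf _ d.+1%:R) ?pnatr_eq0 // -scalerA; apply: filtZ.
rewrite -(subrK (\sum_(p <- r) actL rM p.1 p.2) (_ *: x)); apply: filtD => //.
rewrite sum_by_index; apply: filt_sum => n _; exact: filtL.
Qed.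

(** * A module with nonzero phi-vectors *)

(* Linear maps from Sym(Span{H_n}) to formal series in t, 1/t: [xi s j] is the
   coefficient of t^j in the value on the monomial with letters [s]; L_n acts on t^j
   by j t^(j+n) and by duality on the H_m.  Words make [wordL] a structural
   recursion; commutation of the H_m is imposed afterwards by [symmetric_word]. *)
Definition word_fun : lmodType C := seq int -> int -> C.

Fixpoint wordL (n : int) (xi : seq int -> int -> C) (s : seq int) : int -> C :=
  match s with
  | [::] => fun j => (j - n)%:~R * xi [::] (j - n)
  | m :: s' => fun j =>
      wordL n (fun t => xi (m :: t)) s' j - m%:~R * xi (m + n :: s') j
  end.

Definition wordH (m : int) (xi : seq int -> int -> C) : seq int -> int -> C :=
  fun s => xi (m :: s).

Lemma word_funE (a : C) (x y : word_fun) s j :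
  (a *: x + y) s j = a * x s j + y s j.
Proof. by []. Qed.

Lemma wordL_linear n : linear (wordL n : word_fun -> word_fun).
Proof.
move=> a x y; apply/funext => s.
elim: s x y => [|m s IH] x y; apply/funext => j; rewrite word_funE /=.
  by rewrite word_funE; ring.
have /(congr1 (fun f => f j)) := IH (wordH m x) (wordH m y).
by rewrite !word_funE /wordH => ->; ring.
Qed.

HB.instance Definition _ n :=
  GRing.isLinear.Build C word_fun word_fun *:%R (wordL n) (wordL_linear n).

Lemma wordH_linear n : linear (wordH n : word_fun -> word_fun).
Proof. by []. Qed.

HB.instance Definition _ n :=
  GRing.isLinear.Build C word_fun word_fun *:%R (wordH n) (wordH_linear n).

Lemma wordLH n m xi s j :
  wordL n (wordH m xi) s j - wordH m (wordL n xi) s j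
  = m%:~R * wordH (m + n) xi s j.
Proof. by rewrite /wordH /=; ring. Qed.

Lemma wordLL n m (xi : word_fun) s j :
  wordL n (wordL m xi) s j - wordL m (wordL n xi) s j
  = (m - n)%:~R * wordL (m + n) xi s j.
Proof.
elim: s xi j => [|k s IH] xi j /=.
  have -> : j - n - m = j - m - n by ring.
  have -> : j - (m + n) = j - m - n by ring.
  by rewrite !intrB; ring.
(* Peeling off the letter k is the relation H_k L_q = L_q H_k - k H_(k+q). *)
have step p q : wordL p (fun t => wordL q xi (k :: t)) s j
    = wordL p (wordL q (wordH k xi)) s j - k%:~R * wordL p (wordH (k + q) xi) s j.
  have -> : (fun t => wordL q xi (k :: t))
      = (- k%:~R) *: (wordH (k + q) xi : word_fun) + (wordL q (wordH k xi) : word_fun).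
    by apply/funext => t; apply/funext => i; rewrite word_funE /wordH /=; ring.
  by rewrite (wordL_linear p) word_funE; ring.
rewrite !step; have := IH (wordH k xi) j; rewrite /wordH.
set A := wordL n _ s j; set B := wordL m _ s j; set D := wordL (m + n) _ s j.
move=> /(congr1 (fun z => z + B)); rewrite subrK => ->.
have -> : k + n + m = k + (m + n) by ring.
have -> : k + m + n = k + (m + n) by ring.
by rewrite !intrB !intrD; ring.
Qed.

Definition symmetric_word (xi : word_fun) : Prop :=
  forall s a b t, xi (s ++ a :: b :: t) = xi (s ++ b :: a :: t).

Lemma symmetric_word_subspace : subspace symmetric_word.
Proof.
split=> // c x y hx hy s a b t.
by apply/funext => j; rewrite !fctE hx hy.
Qed.

Lemma symmetric_wordH n xi :
  symmetric_word xi -> symmetric_word (wordH n xi).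
Proof. by move=> h s; apply: (h (n :: s)). Qed.

Lemma symmetric_wordL n xi :
  symmetric_word xi -> symmetric_word (wordL n xi).
Proof.
move=> + s; elim: s xi => [|c s IH] xi h a b t; apply/funext => j /=.
  (* When the swapped letters come first, the swap exchanges their two correction terms, up to
     symmetry of [xi]. *)
  have -> : (fun u => xi (a :: b :: u)) = (fun u => xi (b :: a :: u)).
    by apply/funext => u; exact: (h [::]).
  by rewrite (h [::] (a + n) b) (h [::] a (b + n)) /=; ring.
rewrite (IH (fun u => xi (c :: u)) (symmetric_wordH c h)).
by rewrite -!cat_cons h.
Qed.

Definition word_space : lmodType C := subspace_of symmetric_word_subspace.

Definition word_module : gca_module word_space.
Proof.
pose L n : {linear word_fun -> word_fun} := wordL n.
pose H n : {linear word_fun -> word_fun} := wordH n.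
pose Z (n : int) : {linear word_fun -> word_fun} := \0.
apply: (@subspace_module word_fun _ symmetric_word_subspace L H Z Z) => n;
  [exact: symmetric_wordL|exact: symmetric_wordH|by []|by []|move=> m v hv..].
- by apply/funext => s; apply/funext => j; exact: wordLL.
- by apply/funext => s; apply/funext => j; exact: wordLH.
- by rewrite linear0 scaler0 subr0.
- by rewrite linear0 scaler0 subr0.
- by rewrite linear0 subr0.
- by rewrite linear0 subr0 oppr0.
- by apply/eqP; rewrite subr_eq0; apply/eqP/funext => s; exact: (hv [::]).
- by rewrite subr0.
- by rewrite subr0.
- by rewrite subr0.
Defined.

(** The character of Sym(Span{H_n}) sending H_n to [c n], times the series [u]; it is a common
    eigenvector of the H_n. *)
Definition word_char (c : int -> C) (u : int -> C) : word_fun :=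
  fun s j => (\prod_(i <- s) c i) * u j.

Lemma word_char_symmetric c u : symmetric_word (word_char c u).
Proof.
move=> s a b t; apply/funext => j; congr (_ * _).
by rewrite !big_cat !big_cons /= [c a * (c b * _)]mulrCA.
Qed.

Definition word_vector c u : word_space :=
  to_subspace symmetric_word_subspace (word_char_symmetric c u).

Lemma word_phi_vector c phiI phiJ u :
  (forall n, phiI n = 0) -> (forall n, phiJ n = 0) ->
  phi_vector word_module c phiI phiJ (word_vector c u).
Proof.
move=> I0 J0 n; rewrite I0 J0 !scale0r; split; last by split; apply: val_inj.
apply: val_inj; rewrite linearZ; apply/funext => s; apply/funext => j.
by rewrite /= /wordH /word_char big_cons -mulrA.
Qed.

(** The correction terms carry m c_(m+k), which vanishes for every m when [c] is supported in {k};
    so L_k acts on the series alone. *)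
Lemma wordL_char (c : int -> C) k u s j : (forall n, c n != 0 -> n = k) ->
  wordL k (word_char c u) s j = word_char c (fun j => (j - k)%:~R * u (j - k)) s j.
Proof.
move=> ck; elim: s => [|m s IH] /=; first by rewrite /word_char !big_nil !mul1r.
have -> : m%:~R * word_char c u (m + k :: s) j = 0.
  rewrite /word_char big_cons; have [->|/ck mk] := eqVneq (c (m + k)) 0.
    by rewrite !mul0r mulr0.
  have -> : m = 0 by lia.
  exact: mul0r.
have -> : (fun t => word_char c u (m :: t)) = c m *: (word_char c u).
  by apply/funext => t; apply/funext => i; rewrite /word_char big_cons -mulrA.
have -> : wordL k (c m *: (word_char c u : word_fun)) = c m *: wordL k (word_char c u).
  by have := wordL_linear k (c m) (word_char c u) 0; rewrite addr0 linear0 addr0.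
by rewrite subr0 /= !fctE IH /word_char big_cons -mulrA.
Qed.

Lemma induced_gen_neq0 (M : lmodType C) (rM : gca_module M) (w : M)
    phiH phiI phiJ :
  (forall n, phiI n = 0) -> (forall n, phiJ n = 0) ->
  is_induced_module rM w phiH phiI phiJ -> w != 0.
Proof.
move=> I0 J0 [_ univ]; apply/eqP => w0.
have [f [_ [fw _]]] := univ _ _ _ (word_phi_vector phiH (fun=> 1) I0 J0).
have /(congr1 (fun x => val x [::] 0)) := fw.
rewrite w0 linear0 /= /word_char big_nil mulr1 => /esym/eqP.
by rewrite oner_eq0.
Qed.

(** * Reducibility when the support has at most one point *)

Lemma kernel_submodule (M N : lmodType C) (rM : gca_module M) (rN : gca_module N)
    (f : {linear M -> N}) :
  gca_hom rM rN f -> gca_submodule rM (fun x => f x = 0).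
Proof.
move=> hf; split=> [|x y fx fy|a x fx|n x fx]; first by rewrite linear0.
- by rewrite linearD /= fx fy addr0.
- by rewrite linearZ /= fx scaler0.
by have [-> [-> [-> ->]]] := hf n x; rewrite fx !linear0.
Qed.

Lemma induced_reducible (M : lmodType C) (rM : gca_module M) (w : M)
    phiH phiI phiJ k :
  (forall n, phiI n = 0) -> (forall n, phiJ n = 0) ->
  (forall n, phiH n != 0 -> n = k) ->
  is_induced_module rM w phiH phiI phiJ -> ~ gca_irreducible rM.
Proof.
move=> I0 J0 Hk [_ univ] [_ irr].
(* [e i] is the series t^i: L_k kills t^0 but sends t to t^(k+1). *)
pose e (i j : int) : C := (j == i)%:R.
have [f0 [hf0 [f0w _]]] := univ _ _ _ (word_phi_vector phiH (e 0) I0 J0).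
have [f1 [hf1 [f1w _]]] := univ _ _ _ (word_phi_vector phiH (e 1) I0 J0).
have [ker0|ker] := irr _ (kernel_submodule hf0).
- have Lw0 : actL rM k w = 0.
    apply: ker0; have [-> _] := hf0 k w; rewrite f0w.
    apply: val_inj; apply/funext => s; apply/funext => j.
    rewrite [LHS](wordL_char _ _ _ Hk) /word_char /e.
    by case: eqP => [->|_]; rewrite ?mul0r !mulr0.
  have [+ _] := hf1 k w; rewrite Lw0 linear0 f1w.
  move=> /(congr1 (fun x => val x [::] (k + 1))).
  rewrite [RHS](wordL_char _ _ _ Hk) /word_char /e big_nil mul1r (addrC k) addrK.
  by rewrite eqxx mulr1 => /esym/eqP; rewrite oner_eq0.
have := ker w; rewrite f0w => /(congr1 (fun x => val x [::] 0)).
by rewrite /= /word_char /e big_nil eqxx mulr1 => /eqP; rewrite oner_eq0.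
Qed.

Theorem theorem4p5 (phiH phiI phiJ : int -> C)
  (hphi : p_lie_hom phiH phiI phiJ) (hfin : S_finite phiH)
  (M : lmodType C) (rM : gca_module M) (w : M)
  (hW : is_induced_module rM w phiH phiI phiJ) :
  gca_irreducible rM <-> S_card_ge2 phiH.
Proof.
have I0 n : phiI n = 0 by have [] := hphi 0 n; rewrite addr0.
have J0 n : phiJ n = 0.
  by have [_ /eqP] := hphi 0 n; rewrite addr0 oppr_eq0 => /eqP.
split=> [irr|card].
  apply: contrapT => card.
  suff [k Hk] : exists k, forall n, phiH n != 0 -> n = k.
    exact: induced_reducible I0 J0 Hk hW irr.
  have [[k Hk]|no] := pselect (exists k, phiH k != 0).
    exists k => n Hn; apply: contrapT => /eqP nk.
    by apply: card; exists n, k.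
  (* For empty support any k would serve. *)
  by exists 0 => n Hn; case: no; exists n.
split; first by exists w; exact: induced_gen_neq0 I0 J0 hW.
move=> P hP.
have [[x [Px x0]]|no] := pselect (exists x, P x /\ x != 0).
  right; apply: (induced_generated hW hP).
  have [d hx] := filt_exhaustive I0 J0 hW x.
  exact: submodule_gen (proj1 hW) hfin card hP Px x0 hx.
left=> x Px; apply: contrapT => /eqP x0; by apply: no; exists x.
Qed.
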